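(* Let $f\in\mathcal{F}_L(\mathbb{R}^N)$, let $\mathcal{D}\subseteq\mathcal{S}^{N-1}$ be a $\theta$-cover, let $x(0)\in\mathbb{R}^N$, and let the iterates $x(t)$ be generated with constant step-size $\gamma$ by $x(t+1)=x(t)-\gamma d(t)$, $t=0,1,2,\ldots$, where $d(t)\in\mathcal{D}$ satisfies $\mathrm{ang}(\nabla f(x(t)),d(t))\leq\theta$ whenever $\nabla f(x(t))\neq 0$ (and $d(t)\in\mathcal{D}$ is arbitrary otherwise). Then for any $\epsilon>0$: a) there exist a step-size $\gamma>0$ and $T\in\mathbb{N}$ such that $f(x(t))-f^\star<\epsilon$ for all $t\geq T$; b) moreover, if $f$ is $\mu$-strongly convex (with $\mu>0$) and $\gamma\in(0,\bar\gamma)$ where $$\bar\gamma=\min\left\{\frac{2\cos(\theta)\sqrt{\mu\epsilon}}{L},\sqrt{\frac{\epsilon}{L}}\right\},$$ then there is a nonnegative integer $T$ with $$T\leq\left\lceil\frac{2(f(x(0))-f^\star)}{\gamma(2\cos(\theta)\sqrt{\mu\epsilon}-L\gamma)}\right\rceil$$ such that $f(x(t))-f^\star\leq\epsilon$ for all $t\geq T$.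
   Context: $N\geq 1$, $L>0$, $\|\cdot\|$ is the Euclidean norm and $\mathcal{S}^{N-1}$ is the unit sphere in $\mathbb{R}^N$. For nonzero $u,v\in\mathbb{R}^N$, $\mathrm{ang}(u,v)=\cos^{-1}\big(\langle u,v\rangle/(\|u\|\|v\|)\big)$. Class $\mathcal{F}_L(\mathbb{R}^N)$: the set of functions $f:\mathbb{R}^N\to\mathbb{R}$ that are convex and differentiable with $L$-Lipschitz continuous gradient and whose set of minimizers $\mathcal{X}^\star=\arg\min_{x\in\mathbb{R}^N} f(x)$ is nonempty and bounded; $f^\star=\min_{x\in\mathbb{R}^N}f(x)$. $\theta$-cover: a finite set $\mathcal{D}\subseteq\mathcal{S}^{N-1}$ is a $\theta$-cover if $\theta\in[0,\pi/2)$ and for all $g\in\mathcal{S}^{N-1}$ there is $d\in\mathcal{D}$ such that $\mathrm{ang}(g,d)\leq\theta$. *)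

(* Defs.v *)
From HB Require Import structures.
From mathcomp Require Import all_boot all_order all_algebra.
From mathcomp Require Import all_classical all_reals all_analysis.
Import Order.TTheory GRing.Theory Num.Theory.
Import numFieldNormedType.Exports.

Set Implicit Arguments.
Unset Strict Implicit.
Unset Printing Implicit Defensive.

Local Open Scope classical_set_scope.
Local Open Scope ring_scope.

(* Vectors of R^N are row vectors. The library norm `|x| on 'rV[R]_N is the
   sup norm, so the Euclidean norm is introduced separately. The library's
   [differentiable] and [bounded_set] are used as they are: both notions are
   the same for all norms on R^N. *)
Section Euclidean.
Context {R : realType} {N : nat}.
Implicit Types u v : 'rV[R]_N.

Definition dotp u v : R := (u *m v^T) 0 0.

Definition enorm u : R := Num.sqrt (dotp u u).

(* Meaningful for nonzero u and v only. *)
Definition ang u v : R := acos (dotp u v / (enorm u * enorm v)).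

Definition usphere : set 'rV[R]_N := [set u | enorm u = 1].

Definition theta_cover (theta : R) (D : set 'rV[R]_N) : Prop :=
  [/\ finite_set D,
      D `<=` usphere,
      0 <= theta < pi / 2
    & forall g, usphere g -> exists2 d, D d & ang g d <= theta].

End Euclidean.

Section Functions.
Context {R : realType} {N : nat}.
Implicit Types f : 'rV[R]_N -> R.

Definition grad f (x : 'rV[R]_N) : 'rV[R]_N :=
  \row_(i < N) 'D_(delta_mx 0 i) f x.

Definition argmin f : set 'rV[R]_N := [set x | forall y, f x <= f y].

(* v is attained by f and is a lower bound of its values: v = min f. *)
Definition is_min f (v : R) : Prop := range f v /\ lbound (range f) v.

Record class_F (L : R) f : Prop := {
  class_F_convex : @convex_function R 'rV[R]_N setT f;
  class_F_differentiable : forall x, differentiable f x;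
  class_F_lipschitz_grad :
    forall x y, enorm (grad f x - grad f y) <= L * enorm (x - y);
  class_F_argmin_nonempty : argmin f !=set0;
  class_F_argmin_bounded : bounded_set (argmin f) }.

Definition strongly_convex (mu : R) f : Prop :=
  forall (x y : 'rV[R]_N) (s : R), 0 <= s <= 1 ->
    f (s *: x + (1 - s) *: y) <=
      s * f x + (1 - s) * f y - mu / 2 * s * (1 - s) * enorm (x - y) ^+ 2.

(* x is a run of the method from x0 with step-size gamma and directions d;
   d t is any element of D when the gradient at x t vanishes. *)
Definition quantized_descent f (D : set 'rV[R]_N) (theta gamma : R)
    (x0 : 'rV[R]_N) (x d : nat -> 'rV[R]_N) : Prop :=
  x 0%N = x0 /\
  forall t : nat,
    [/\ D (d t),
        grad f (x t) <> 0 -> ang (grad f (x t)) (d t) <= theta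
      & x t.+1 = x t - gamma *: d t].

End Functions.

(* Main.v *)
Require Import Defs.
From HB Require Import structures.
From mathcomp Require Import all_boot all_order all_algebra.
From mathcomp Require Import all_classical all_reals all_analysis.
From mathcomp Require Import lra.
Import Order.TTheory GRing.Theory Num.Theory.
Import numFieldNormedType.Exports.
Local Open Scope classical_set_scope.
Local Open Scope ring_scope.

(** The gap [f (x t) - fstar] falls by a fixed amount at every step as long as it
    is at least [eps / 2], and once below [eps / 2] it never exceeds [eps] again.

    Every direction of [D] is a unit vector, so the descent lemma bounds the value
    after a step by [f x - gamma * dotp (grad f x) d + L / 2 * gamma ^+ 2], and the
    angle condition makes the scalar product at least
    [cos theta * enorm (grad f x)] ([quantized_step]). A step therefore raises
    [f] by at most [L / 2 * gamma ^+ 2], whatever the gradient is, and it lowers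
    [f] by a fixed amount wherever the gradient norm is at least some [G] with
    [L * gamma < 2 * cos theta * G] ([quantized_descent_le]). Only a lower bound
    [G] for the gradient norm on the region where the gap is at least [eps / 2]
    remains to be found.

    Under strong convexity the Polyak-Lojasiewicz inequality gives
    [G = Num.sqrt (mu * eps)], whence the explicit step-size and number of steps.
    For a merely convex [f] the values along a run stay below a fixed level; as
    the set of minimizers is bounded, this sublevel set lies within some distance
    [r] of a minimizer ([convex_sublevel_bounded]), and the tangent inequality
    gives a [G] of order [eps / r]. *)

(** * Euclidean geometry *)

Section EuclideanFacts.
Context {R : realType} {N : nat}.
Implicit Types (u v w g d : 'rV[R]_N) (a theta : R).

Lemma dotpE u v : dotp u v = \sum_i u 0 i * v 0 i.
Proof. by rewrite /dotp mxE; apply: eq_bigr => i _; rewrite mxE. Qed.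

Lemma dotpC u v : dotp u v = dotp v u.
Proof. by rewrite !dotpE; apply: eq_bigr => i _; rewrite mulrC. Qed.

Lemma dotpDr w u v : dotp w (u + v) = dotp w u + dotp w v.
Proof. by rewrite /dotp linearD mulmxDr mxE. Qed.

Lemma dotpZr a u v : dotp u (a *: v) = a * dotp u v.
Proof. by rewrite /dotp linearZ -scalemxAr mxE. Qed.

Lemma dotpNr u v : dotp u (- v) = - dotp u v.
Proof. by rewrite -scaleN1r dotpZr mulN1r. Qed.

Lemma dotpDl w u v : dotp (u + v) w = dotp u w + dotp v w.
Proof. by rewrite dotpC dotpDr !(dotpC w). Qed.

Lemma dotpZl a u v : dotp (a *: u) v = a * dotp u v.
Proof. by rewrite dotpC dotpZr dotpC. Qed.

Lemma dotpNl u v : dotp (- u) v = - dotp u v.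
Proof. by rewrite dotpC dotpNr dotpC. Qed.

Lemma dotp_ge0 u : 0 <= dotp u u.
Proof. by rewrite dotpE; apply: sumr_ge0 => i _; rewrite -expr2 sqr_ge0. Qed.

Lemma enorm_ge0 u : 0 <= enorm u.
Proof. exact: sqrtr_ge0. Qed.

Lemma enorm_sqr u : enorm u ^+ 2 = dotp u u.
Proof. by rewrite sqr_sqrtr// dotp_ge0. Qed.

Lemma enorm_eq0 u : (enorm u == 0) = (u == 0).
Proof.
apply/idP/eqP => [|->]; last first.
  by rewrite /enorm dotpE big1 ?sqrtr0// => i _; rewrite mxE mul0r.
rewrite -sqrf_eq0 enorm_sqr dotpE psumr_eq0; last first.
  by move=> i _; rewrite -expr2 sqr_ge0.
move=> /allP u0; apply/rowP => i; rewrite mxE.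
by have := u0 i (mem_index_enum i); rewrite mulf_eq0 orbb => /eqP.
Qed.

Lemma enormZ a u : enorm (a *: u) = `|a| * enorm u.
Proof.
by rewrite /enorm dotpZl dotpZr mulrA -expr2 sqrtrM ?sqr_ge0// sqrtr_sqr.
Qed.

Lemma enormN u : enorm (- u) = enorm u.
Proof. by rewrite -scaleN1r enormZ normrN1 mul1r. Qed.

(** Cauchy-Schwarz, from expanding the square of
    [enorm v *: u - enorm u *: v]. *)
Lemma dotp_le_enorm u v : dotp u v <= enorm u * enorm v.
Proof.
have [->|u0] := eqVneq u 0.
  by rewrite -[X in dotp X _](scale0r v) dotpZl mul0r mulr_ge0 ?enorm_ge0.
have [->|v0] := eqVneq v 0.
  by rewrite -[X in dotp _ X](scale0r u) dotpZr mul0r mulr_ge0 ?enorm_ge0.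
have a0 : 0 < enorm u by rewrite lt0r enorm_eq0 u0 enorm_ge0.
have b0 : 0 < enorm v by rewrite lt0r enorm_eq0 v0 enorm_ge0.
have ab0 : 0 < enorm u * enorm v by rewrite mulr_gt0.
have := dotp_ge0 (enorm v *: u - enorm u *: v).
rewrite !(dotpDl, dotpDr, dotpNl, dotpNr, dotpZl, dotpZr).
rewrite -!enorm_sqr (dotpC v u).
move=> H; rewrite -(ler_pM2l ab0); nra.
Qed.

Lemma normr_dotp_le u v : `|dotp u v| <= enorm u * enorm v.
Proof.
by rewrite ler_norml dotp_le_enorm andbT lerNl -dotpNl -(enormN u) dotp_le_enorm.
Qed.

(** Since [cos] decreases on [[0, pi]] and [ang g d] is the [acos] of
    [dotp g d / enorm g], a bound on the angle is a lower bound on the scalar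
    product. At [g = 0], where the angle is meaningless, both sides vanish, so
    that the iterations with a zero gradient need no separate treatment. *)
Lemma ang_le_dotp theta g d : 0 <= theta <= pi -> enorm d = 1 ->
  (g <> 0 -> ang g d <= theta) -> cos theta * enorm g <= dotp g d.
Proof.
move=> thetapi d1; have [->|/eqP g0 /(_ g0)] := eqVneq g 0.
  move=> _; rewrite -[X in dotp X _](scale0r d) dotpZl mul0r.
  have /eqP -> : enorm (0 : 'rV[R]_N) == 0 by rewrite enorm_eq0.
  by rewrite mulr0.
have g_gt0 : 0 < enorm g by rewrite lt0r enorm_eq0 enorm_ge0 andbT; apply/eqP.
rewrite /ang d1 mulr1 => ang_le.
have ratio1 : -1 <= dotp g d / enorm g <= 1.
  rewrite -ler_norml normrM normfV (gtr0_norm g_gt0) ler_pdivrMr// mul1r.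
  by rewrite (le_trans (normr_dotp_le _ _))// d1 mulr1.
have [acospi cosacos] := acos_def ratio1.
rewrite -ler_pdivlMr// -cosacos.
have [->//|ne] := eqVneq theta (acos (dotp g d / enorm g)).
by rewrite ltW// ltr_cos ?in_itv//= lt_neqAle eq_sym ne ang_le.
Qed.

(** The norm on the right is the sup norm, in which boundedness and compactness
    are expressed; this turns a sup-norm bound into a Euclidean one. *)
Lemma enorm_le_norm u : enorm u <= Num.sqrt N%:R * `|u|.
Proof.
rewrite -[X in _ * X]ger0_norm// -sqrtr_sqr -sqrtrM// ler_wsqrtr// dotpE.
apply: (@le_trans _ _ (\sum_(i < N) `|u| ^+ 2)); last first.
  by rewrite sumr_const card_ord mulr_natl.
apply: ler_sum => i _.
rewrite -expr2 -real_normK ?num_real// lerXn2r ?nnegrE//.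
rewrite [leRHS]/Num.norm/= mx_normrE.
exact: (le_bigmax _ (fun ij : 'I_1 * 'I_N => `|u ij.1 ij.2|) (0, i)).
Qed.

End EuclideanFacts.

(** * Gradient inequalities *)

Section Gradient.
Context {R : realType} {N : nat}.
Context (f : 'rV[R]_N -> R).
Implicit Types (x y v : 'rV[R]_N) (s mu : R).

Lemma derive_dotp_grad x v : differentiable f x ->
  'D_v f x = dotp (grad f x) v.
Proof.
move=> df; rewrite deriveE// {1}(row_sum_delta v) linear_sum dotpE.
by apply: eq_bigr => i _; rewrite linearZ/= !mxE deriveE// mulrC.
Qed.

Lemma is_derive_line x v s : differentiable f (x + s *: v) ->
  is_derive s 1 (fun r : R => f (x + r *: v)) (dotp (grad f (x + s *: v)) v).
Proof.
move=> df.
have [dfx <-] : is_derive (x + s *: v) v f (dotp (grad f (x + s *: v)) v).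
  by apply: DeriveDef; [exact: diff_derivable|exact: derive_dotp_grad].
pose phi (r : R) := f (x + r *: v).
(* Both derivatives are limits of the same difference quotient. *)
have quotE : (fun h : R => h^-1 *: ((phi \o shift s) (h *: 1) - phi s)) =
    (fun h : R => h^-1 *: ((f \o shift (x + s *: v)) (h *: v)
                           - f (x + s *: v))).
  apply/funext => h; congr (_ *: (f _ - _)).
  by rewrite /= [h *: 1]mulr1 scalerDl addrCA addrA.
by apply: DeriveDef; rewrite /derivable /derive quotE.
Qed.

(** The derivative of the remainder [phi] at [r] is the scalar product of
    [grad f (x + r *: v) - grad f x] with [v], minus [L * r * enorm v ^+ 2]:
    it is nonpositive by Cauchy-Schwarz and the Lipschitz bound, so
    [phi 1 <= phi 0]. *)
Lemma descent_lemma (L : R) x v : (forall z, differentiable f z) ->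
  (forall y z, enorm (grad f y - grad f z) <= L * enorm (y - z)) ->
  f (x + v) <= f x + dotp (grad f x) v + L / 2 * enorm v ^+ 2.
Proof.
move=> df lip.
pose q := L / 2 * enorm v ^+ 2.
pose phi (r : R) := f (x + r *: v) - (dotp (grad f x) v * r + q * r ^+ 2).
pose dphi (r : R) :=
  dotp (grad f (x + r *: v)) v - (dotp (grad f x) v + L * enorm v ^+ 2 * r).
have dphiP r : is_derive (r : R) (1 : R) phi (dphi r).
  have d1 := is_derive_line x v r (df _).
  have d2 : is_derive r (1 : R)
      (fun z : R => dotp (grad f x) v * z + q * z ^+ 2)
      (dotp (grad f x) v + L * enorm v ^+ 2 * r).
    have did := is_derive_id r (1 : R).
    have d3 := is_deriveD (is_deriveZ (dotp (grad f x) v) did)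
                          (is_deriveZ q (is_deriveX 2 did)).
    rewrite (_ : (fun z => _) =
        dotp (grad f x) v \*: id + q \*: id ^+ 2); last first.
      by apply/funext => z; rewrite exprfctE.
    apply: (is_derive_eq d3).
    by rewrite /q /GRing.scale/=; lra.
  exact: is_deriveB d1 d2.
have [r r01 phiE] : exists2 r, r \in `[0, 1] & phi 1 - phi 0 = dphi r * (1 - 0).
  apply: MVT_segment => //.
  apply: continuous_subspaceT => r.
  apply/differentiable_continuous/derivable1_diffP.
  by case: (dphiP r).
have {r01}/andP[r0 _] : 0 <= r <= 1 by move: r01; rewrite in_itv.
have : dphi r <= 0.
  have := dotp_le_enorm (grad f (x + r *: v) - grad f x) v.
  have := lip (x + r *: v) x; rewrite addrAC subrr add0r enormZ (ger0_norm r0).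
  move=> /(ler_wpM2r (enorm_ge0 v)) h /le_trans/(_ h).
  rewrite dotpDl dotpNl /dphi; lra.
move: phiE; rewrite /phi /q !scale0r !scale1r addr0; lra.
Qed.

(** With [h *: y + (1 - h) *: x = x + h *: (y - x)], dividing the strong
    convexity inequality by [h] bounds the difference quotient of [f] at [x]
    in the direction [y - x]; [h] then tends to [0] from the right. The case
    [mu = 0] is the tangent inequality for convex functions. *)
Lemma strongly_convex_grad mu x y :
  strongly_convex mu f -> differentiable f x ->
  f x + dotp (grad f x) (y - x) + mu / 2 * enorm (y - x) ^+ 2 <= f y.
Proof.
move=> fsc df; set v := y - x.
have dfv : derivable f x v by exact: diff_derivable.
rewrite -derive_dotp_grad// -lerBrDr -lerBrDl.
have : (h^-1 *: ((f \o shift x) (h *: v) - f x)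
    - mu / 2 * enorm v ^+ 2 * h) @[h --> 0^'+] -->
    'D_v f x - mu / 2 * enorm v ^+ 2 * 0.
  apply: cvgB; first exact: (cvg_dnbhs_at_right dfv).
  by apply: cvgM; [exact: cvg_cst|exact: cvg_at_right_filter].
rewrite mulr0 subr0 => cvg_quot.
apply: (cvgr_to_le cvg_quot).
near=> h.
have h0 : 0 < h by [].
have h1 : 0 <= h <= 1 by rewrite ltW//=; near: h; apply: nbhs_right_le.
have := fsc y x h h1.
rewrite (_ : h *: y + (1 - h) *: x = h *: v + x); last first.
  by rewrite /v scalerBr scalerBl scale1r addrA addrAC.
rewrite -/v /= => H.
rewrite -[_ *: _]/(_ * _) lerBlDr mulrC ler_pdivrMr//.
nra.
Unshelve. all: by end_near.
Qed.

Lemma convex_gap_le x y : strongly_convex 0 f -> differentiable f x ->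
  f x - f y <= enorm (grad f x) * enorm (x - y).
Proof.
move=> fc df; have := strongly_convex_grad _ x y fc df.
have := dotp_le_enorm (grad f x) (x - y).
rewrite -(opprB y x) dotpNr; lra.
Qed.

(** The Polyak-Lojasiewicz inequality: for a given gradient, the quadratic
    lower bound [strongly_convex_grad] allows [f x - f y] to be largest when
    [enorm (y - x) = enorm (grad f x) / mu]. *)
Lemma polyak_lojasiewicz mu x y :
  0 < mu -> strongly_convex mu f -> differentiable f x ->
  2 * mu * (f x - f y) <= enorm (grad f x) ^+ 2.
Proof.
move=> mu0 fsc df; have := strongly_convex_grad _ x y fsc df.
have := dotp_le_enorm (grad f x) (x - y).
rewrite -(opprB y x) dotpNr enormN.
have := sqr_ge0 (enorm (grad f x) - mu * enorm (y - x)).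
nra.
Qed.

Lemma convex_strongly_convex0 : @convex_function R 'rV[R]_N setT f ->
  strongly_convex 0 f.
Proof.
move=> fc x y s s01.
have {s01} [s0 s1] := andP s01.
rewrite !mul0r subr0.
exact: (fc (Itv01 s0 s1) x y (in_setT _) (in_setT _)).
Qed.

End Gradient.

(** * Sublevel sets of convex functions *)

(** On a sphere around the minimizer [xs] that is too large to meet the bounded
    set [argmin f], the minimum of [f], attained at some [z], exceeds [f xs]. By
    convexity [f] grows at least linearly beyond that sphere along each ray from
    [xs], which confines every sublevel set. *)
Lemma convex_sublevel_bounded (R : realType) (N : nat) (f : 'rV[R]_N -> R)
    (xs : 'rV[R]_N) (c : R) :
  (0 < N)%N -> strongly_convex 0 f -> continuous f -> argmin f xs ->
  bounded_set (argmin f) ->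
  exists2 r, 0 < r & forall x, f x - f xs <= c -> enorm (x - xs) <= r.
Proof.
move=> N0 fc fcont xsmin [M [Mreal Mbound]].
pose rho := `|M| + `|xs| + 2.
have rho_gt0 : 0 < rho by rewrite ltr_wpDl// addr_ge0.
pose S := [set x : 'rV[R]_N | `|x - xs| = rho].
have dist_cont : continuous (fun x : 'rV[R]_N => `|x - xs|).
  by move=> x; exact: (cvg_norm (cvgB cvg_id (cvg_cst xs))).
have S_compact : compact S.
  apply: bounded_closed_compact.
    exists (rho + `|xs|); split; first exact: num_real.
    move=> M' M'gt x /= xS; apply: ltW; apply: le_lt_trans M'gt.
    by rewrite -{1}(subrK xs x) (le_trans (ler_normD _ _))// xS.
  rewrite (_ : S = (fun x : 'rV[R]_N => `|x - xs|) @^-1` [set rho])//.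
  by apply: preimage_closed => [x _|]; [exact: dist_cont|exact: closed_eq].
have S_nonempty : S !=set0.
  exists (xs + const_mx rho); rewrite /S/= addrAC subrr add0r.
  rewrite [LHS]/Num.norm/= mx_normrE.
  apply/eqP; rewrite eq_le; apply/andP; split.
    by apply: bigmax_le => [|i _]; [exact: ltW|rewrite mxE gtr0_norm].
  apply: le_trans (le_bigmax _ _ (0, Ordinal N0)).
  by rewrite mxE gtr0_norm.
have [z /set_mem zS zmin] :=
  EVT_min_rV S_nonempty S_compact (continuous_subspaceT fcont).
have delta_gt0 : 0 < f z - f xs.
  rewrite subr_gt0 lt_neqAle xsmin andbT; apply/eqP => fE.
  have zargmin : argmin f z by move=> y; rewrite -fE; exact: xsmin.
  have := Mbound (`|M| + 1) _ z zargmin.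
  rewrite ltr_pwDr ?ler_norm// => /(_ isT) /= zM.
  have := ler_normB z xs; rewrite zS /rho; lra.
pose n0 := Num.max rho (rho * c / (f z - f xs)).
have n0_gt0 : 0 < n0 by rewrite lt_max rho_gt0.
have sup_le x : f x - f xs <= c -> `|x - xs| <= n0.
  move=> fxc; rewrite le_max; have [//|n_gt] := leP `|x - xs| rho; rewrite orFb.
  have n_gt0 := lt_trans rho_gt0 n_gt.
  (* The point of the segment from [xs] to [x] that lies on the sphere. *)
  pose s := rho / `|x - xs|.
  have s_gt0 : 0 < s by rewrite divr_gt0.
  have s01 : 0 <= s <= 1 by rewrite ltW//= ler_pdivrMr// mul1r ltW.
  have yS : (s *: x + (1 - s) *: xs) \in S.
    apply/mem_set; rewrite /S/= scalerBl scale1r addrCA addrAC subrr add0r.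
    by rewrite -scalerN -scalerDr normrZ gtr0_norm// /s divfK// gt_eqF.
  have := le_trans (zmin _ yS) (fc x xs s s01).
  rewrite ler_pdivlMr//.
  have snE : s * `|x - xs| = rho by rewrite /s divfK// gt_eqF.
  rewrite -snE => H.
  have : f z - f xs <= s * c by nra.
  move=> /(ler_wpM2r (ltW n_gt0)); lra.
exists (Num.sqrt N%:R * n0) => [|x /sup_le xn0].
  by rewrite mulr_gt0// sqrtr_gt0 ltr0n.
by rewrite (le_trans (enorm_le_norm _))// ler_wpM2l// sqrtr_ge0.
Qed.

(** * The quantized descent method *)

(** Both phases of the method in one statement about the gap [a t]. Above
    [e / 2] it loses [delta] per step; from below [e / 2] it cannot jump over
    [e]. So at each time [t] it is at most [e] or has decreased at every step so
    far, and the latter leaves it nonpositive by time [T]. *)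
Lemma stays_below (R : realType) (a : nat -> R) (e delta : R) (T : nat) :
  0 < e -> 0 < delta ->
  (forall t, e / 2 <= a t <= Num.max (a 0%N) e -> a t.+1 <= a t - delta) ->
  (forall t, a t < e / 2 -> a t.+1 <= e) ->
  a 0%N <= T%:R * delta ->
  forall t, (T <= t)%N -> a t <= e.
Proof.
move=> e0 delta0 adecr asmall a0T t Tt.
have {Tt} tdelta : T%:R * delta <= t%:R * delta by rewrite ler_pM2r// ler_nat.
suff [//|at_le] : a t <= e \/ a t <= a 0%N - t%:R * delta by lra.
elim: t {tdelta} => [|t IH]; first by right; rewrite mul0r subr0.
have [/asmall|e2_le] := ltP (a t) (e / 2); first by left.
have tdelta_ge0 : 0 <= t%:R * delta by rewrite mulr_ge0// ltW.
have a_max : a t <= Num.max (a 0%N) e.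
  by rewrite le_max; case: IH => [->|?]; rewrite ?orbT//; apply/orP; left; lra.
have := adecr t; rewrite e2_le a_max => /(_ isT).
rewrite -natr1 mulrDl mul1r.
by case: IH => ? ?; [left|right]; lra.
Qed.

Lemma ceil_natP (R : realType) (q : R) : 0 <= q ->
  exists2 T : nat, T%:Z = Num.ceil q & q <= T%:R.
Proof.
move=> q0; have c0 : 0 <= Num.ceil q.
  by rewrite ceil_ge0 (lt_le_trans _ q0)// ltrN10.
exists `|Num.ceil q|%N; first by rewrite gez0_abs.
by rewrite -[X in _ <= X]/((Posz _)%:~R) gez0_abs// ceil_ge.
Qed.

Section QuantizedDescent.
Context {R : realType} {N : nat}.
Context (f : 'rV[R]_N -> R) (L theta : R).
Context (f_diff : forall x, differentiable f x).
Context (f_lip : forall x y, enorm (grad f x - grad f y) <= L * enorm (x - y)).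
Context (theta_acute : 0 <= theta < pi / 2).

Lemma cos_acute_gt0 : 0 < cos theta.
Proof.
by case/andP: theta_acute => t0 t1; apply: cos_gt0_pihalf; have := pi_gt0 R; lra.
Qed.

Lemma quantized_step x d gamma : 0 <= gamma -> enorm d = 1 ->
  (grad f x <> 0 -> ang (grad f x) d <= theta) ->
  f (x - gamma *: d) <=
    f x - gamma * (cos theta * enorm (grad f x)) + L / 2 * gamma ^+ 2.
Proof.
move=> g0 d1 angle.
have := descent_lemma f L x (- (gamma *: d)) f_diff f_lip.
rewrite dotpNr dotpZr enormN enormZ d1 mulr1 (ger0_norm g0).
have thetapi : 0 <= theta <= pi.
  by case/andP: theta_acute => t0 t1; have := pi_gt0 R; lra.
have /(ler_wpM2l g0) := ang_le_dotp _ _ _ thetapi d1 angle.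
lra.
Qed.

(** The common core of both claims. Wherever the gap is at least [e / 2] and not
    larger than it can become along a run, the gradient has norm at least [G],
    and [quantized_step] then lowers [f] by at least
    [gamma * (2 * cos theta * G - L * gamma) / 2]; this bounds the time to get
    below [e]. From below [e / 2], a step raises [f] by at most
    [L * gamma ^+ 2 / 2 <= e / 2]. *)
Lemma quantized_descent_le (D : set 'rV[R]_N) (fstar e G gamma : R)
    (x0 : 'rV[R]_N) :
  D `<=` usphere -> fstar <= f x0 -> 0 < e -> 0 < gamma ->
  L * gamma ^+ 2 <= e -> L * gamma < 2 * cos theta * G ->
  (forall y, e / 2 <= f y - fstar <= Num.max (f x0 - fstar) e ->
     G <= enorm (grad f y)) ->
  exists T : nat,
    T%:Z <= Num.ceil (2 * (f x0 - fstar) /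
              (gamma * (2 * cos theta * G - L * gamma))) /\
    forall x d : nat -> 'rV[R]_N,
      quantized_descent f D theta gamma x0 x d ->
      forall t : nat, (T <= t)%N -> f (x t) - fstar <= e.
Proof.
move=> Dsph fx0 e0 g0 Lg2 LgG gradG.
have den_gt0 : 0 < gamma * (2 * cos theta * G - L * gamma).
  by rewrite mulr_gt0// subr_gt0.
have [|T TE T_ge] := ceil_natP _ (2 * (f x0 - fstar) /
    (gamma * (2 * cos theta * G - L * gamma))).
  by rewrite divr_ge0 ?(ltW den_gt0)// mulr_ge0// subr_ge0.
exists T; split=> [|x d [x0E run]]; first by rewrite TE.
rewrite ler_pdivrMr// in T_ge.
have step t : f (x t.+1) <=
    f (x t) - gamma * (cos theta * enorm (grad f (x t))) + L / 2 * gamma ^+ 2.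
  have [Dd angle ->] := run t.
  by apply: quantized_step => //; [exact: ltW|exact: Dsph].
have cos0 := cos_acute_gt0.
apply: (stays_below _ (fun t => f (x t) - fstar) _
  (gamma * (2 * cos theta * G - L * gamma) / 2)) => //.
- by rewrite divr_gt0.
- move=> t; rewrite x0E => /gradG /(ler_wpM2l (ltW cos0)) /(ler_wpM2l (ltW g0)).
  have := step t; lra.
- move=> t gap_small; have := step t.
  have : 0 <= gamma * (cos theta * enorm (grad f (x t))).
    by rewrite !mulr_ge0 ?enorm_ge0// ltW.
  lra.
- rewrite x0E; lra.
Qed.

End QuantizedDescent.

Theorem theorem7 (R : realType) (N : nat) (N_ge1 : (1 <= N)%N)
    (L : R) (L_gt0 : 0 < L)
    (f : 'rV[R]_N -> R) (fF : class_F L f)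
    (fstar : R) (fstar_min : is_min f fstar)
    (theta : R) (D : set 'rV[R]_N) (Dcover : theta_cover theta D)
    (x0 : 'rV[R]_N) (eps : R) (eps_gt0 : 0 < eps) :
  (exists (gamma : R) (T : nat), 0 < gamma /\
     forall x d : nat -> 'rV[R]_N,
       quantized_descent f D theta gamma x0 x d ->
       forall t : nat, (T <= t)%N -> f (x t) - fstar < eps)
  /\
  (forall mu : R, 0 < mu -> strongly_convex mu f ->
   forall gamma : R, 0 < gamma ->
     gamma < Num.min (2 * cos theta * Num.sqrt (mu * eps) / L)
                     (Num.sqrt (eps / L)) ->
   exists T : nat,
     T%:Z <= Num.ceil (2 * (f x0 - fstar) /
               (gamma * (2 * cos theta * Num.sqrt (mu * eps) - L * gamma))) /\
     forall x d : nat -> 'rV[R]_N,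
       quantized_descent f D theta gamma x0 x d ->
       forall t : nat, (T <= t)%N -> f (x t) - fstar <= eps).
Proof.
have [fc fd flip _ fbounded] := fF.
have [_ Dsph theta_acute _] := Dcover.
have [[xs _ fxs] fstar_lb] := fstar_min.
have gap_ge0 y : 0 <= f y - fstar by rewrite subr_ge0; apply: fstar_lb; exists y.
have fx0 : fstar <= f x0 by rewrite -subr_ge0.
have cos0 := cos_acute_gt0 _ theta_acute.
have fc0 := convex_strongly_convex0 f fc.
split.
  (* Half of [eps] turns the final [<=] into [<]. *)
  pose e := eps / 2.
  have e0 : 0 < e by rewrite divr_gt0.
  have xsmin : argmin f xs by move=> y; rewrite fxs -subr_ge0.
  have fcont : continuous f by move=> y; exact: differentiable_continuous.
  have [r r0 sublevel] := convex_sublevel_bounded _ _ f xs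
    (Num.max (f x0 - fstar) e) N_ge1 fc0 fcont xsmin fbounded.
  pose G := e / (2 * r).
  have G0 : 0 < G by rewrite divr_gt0// mulr_gt0.
  pose gamma := Num.min (Num.sqrt (e / L)) (cos theta * G / L).
  have eL0 : 0 < e / L by rewrite divr_gt0.
  have g0 : 0 < gamma by rewrite lt_min sqrtr_gt0 eL0 divr_gt0// mulr_gt0.
  have Lg : L * gamma <= cos theta * G.
    by rewrite mulrC -ler_pdivlMr// ge_min lexx orbT.
  have Lg2 : L * gamma ^+ 2 <= e.
    rewrite mulrC -ler_pdivlMr// -(sqr_sqrtr (ltW eL0)).
    apply: lerXn2r; rewrite ?nnegrE ?sqrtr_ge0//; first exact: ltW.
    by rewrite ge_min lexx.
  have LgG : L * gamma < 2 * cos theta * G.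
    have := mulr_gt0 cos0 G0; lra.
  have [|T [_ T_le]] := quantized_descent_le f L theta fd flip theta_acute D
    fstar e G gamma x0 Dsph fx0 e0 g0 Lg2 LgG.
    move=> y /andP[e2_le gap_max].
    have := convex_gap_le f y xs fc0 (fd y).
    rewrite fxs in sublevel *.
    have /(ler_wpM2l (enorm_ge0 (grad f y))) := sublevel y gap_max.
    rewrite /G ler_pdivrMr ?mulr_gt0//; lra.
  exists gamma, T; split=> // x d run t Tt.
  by apply: (le_lt_trans (T_le x d run t Tt)); rewrite /e; lra.
move=> mu mu0 fsc gamma g0; rewrite lt_min => /andP[g1 g2].
have Lg2 : L * gamma ^+ 2 <= eps.
  rewrite mulrC -ler_pdivlMr// -(sqr_sqrtr (ltW (divr_gt0 eps_gt0 L_gt0))).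
  by apply: lerXn2r; rewrite ?nnegrE ?sqrtr_ge0//; exact: ltW.
apply: (quantized_descent_le f L theta fd flip theta_acute) => //.
  by rewrite mulrC -ltr_pdivlMr.
move=> y /andP[e2_le _].
rewrite -[leRHS]ger0_norm ?enorm_ge0// -sqrtr_sqr ler_wsqrtr//.
have := polyak_lojasiewicz f mu y xs mu0 fsc (fd y); rewrite fxs.
have /(ler_wpM2l (ltW mu0)) := e2_le; lra.
Qed.
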